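(* Let $z_1,\dots,z_n$ be complex numbers with $\mathrm{Re}\,z_k<0$, $k=1,\dots,n$, let $\mathcal{P}$ be the space of real-valued polynomials by the system of complex exponentials $\varphi_k(t)=e^{z_kt}$, $k=1,\dots,n$, on the half-line $\mathbb{R}_+=[0,+\infty)$, and let $j\ge1$ be an integer. Then the Markov-Bernstein constant $C_j$ of $\mathcal{P}$ on $\mathbb{R}_+$ is the reciprocal of the objective value of the problem $$\|p\|_{C[0,+\infty)}\to\min,\qquad p^{(j)}(0)=1,\quad p\in\mathcal{P}.$$
   Context: All frequencies $z_k$ are of multiplicity one (pairwise distinct). The real-valued polynomials by the system (quasipolynomials) are the real linear combinations of the functions $e^{a_kt}\cos b_kt$ and $e^{a_kt}\sin b_kt$, where $z_k=a_k+ib_k$, i.e. the real parts of complex linear combinations of the $e^{z_kt}$. $\|g\|_{C[0,+\infty)}=\sup_{t\ge0}|g(t)|$. The Markov-Bernstein constant $C_j$ is the sharp (smallest) constant in the inequality $\|p^{(j)}\|_{C[0,+\infty)}\le C_j\|p\|_{C[0,+\infty)}$, $p\in\mathcal{P}$. *)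

(* Defs.v *)
From mathcomp Require Import all_boot all_order all_algebra.
From mathcomp Require Import complex.
From mathcomp Require Import all_classical all_reals all_analysis.
Import Order.TTheory GRing.Theory Num.Theory.
Import numFieldNormedType.Exports.

Set Implicit Arguments.
Unset Strict Implicit.
Unset Printing Implicit Defensive.

Local Open Scope classical_set_scope.
Local Open Scope ring_scope.
Local Open Scope complex_scope.

(* Quasipolynomials are represented by their canonical extensions to the whole
   real line (they are entire), so that the two-sided derivative p^`(j) is also
   the right one at the endpoint 0. *)
Definition quasipolynomial (R : realType) (n : nat) (z : 'I_n -> R[i]) :
    set (R -> R) :=
  [set p | exists c d : 'I_n -> R, p = fun t =>
     \sum_(k < n) (c k * (expR (complex.Re (z k) * t) * cos (complex.Im (z k) * t))
                 + d k * (expR (complex.Re (z k) * t) * sin (complex.Im (z k) * t)))].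

(* Only t >= 0 is taken into account; the value is +oo for a function that is
   unbounded on the half-line. *)
Definition sup_norm (R : realType) (g : R -> R) : \bar R :=
  ereal_sup [set `|g t|%:E | t in [set t : R | 0 <= t]].

Definition markov_bernstein_ineq (R : realType) (P : set (R -> R)) (j : nat)
    (C : R) : Prop :=
  forall p, P p -> (sup_norm (p^`(j))%classic <= C%:E * sup_norm p)%E.

Definition is_markov_bernstein_constant (R : realType) (P : set (R -> R))
    (j : nat) (C : R) : Prop :=
  markov_bernstein_ineq P j C /\ lbound [set C' | markov_bernstein_ineq P j C'] C.

(* Valued in the extended reals: +oo when the problem is infeasible. *)
Definition objective_value (R : realType) (P : set (R -> R)) (j : nat) : \bar R :=
  ereal_inf [set sup_norm p | p in [set p | P p /\ (p^`(j))%classic 0 = 1]].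

(* Main.v *)
Require Import Defs.
From mathcomp Require Import all_boot all_order all_algebra.
From mathcomp Require Import complex.
From mathcomp Require Import all_classical all_reals all_analysis.
From mathcomp Require Import ring.
Import Order.TTheory GRing.Theory Num.Theory.
Import numFieldNormedType.Exports.

(** The space P of quasipolynomials is invariant under the translations
    p |-> p(. + h), and for h >= 0 these do not increase the norm on the
    half-line.  So the value of the j-th derivative at any t >= 0 is its value
    at 0 for another element of P of no larger norm: the best constant C_j is
    the norm of the single linear functional p |-> p^(j)(0) on P, and by
    homogeneity this norm is the reciprocal of the least norm on the hyperplane
    p^(j)(0) = 1.  That is [markov_bernstein_constant_objective], stated for
    any translation-invariant linear class of bounded smooth functions on which
    the functional is bounded and nonzero.

    Both provisos matter: they say that the objective value is neither 0 nor
    infinite.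

    Boundedness comes from finite dimension, without any compactness.  By
    linear algebra, a functional that vanishes on every element of P vanishing
    on the half-line is a linear combination of finitely many evaluations at
    points of the half-line ([functional_bounded]), hence is bounded by a
    multiple of the norm.  The functional p |-> p^(j)(0) is of this kind,
    because a right-sided difference quotient computes a derivative: if p
    vanishes on the half-line, so do all its derivatives, endpoint included
    ([combination_vanishing]).

    For nonvanishing, view P as the pairings of a coefficient vector with the
    curve of rows (Re e^(z_k t), Im e^(z_k t))_k.  On such rows, multiplication
    by a family of complex numbers is right multiplication by a real block
    matrix ([complex_row_scaling]).  Differentiation is the scaling by z,
    translation by h the scaling by e^(z h); as no z_k is 0, differentiation is
    invertible on P ([exp_derivative_nonzero]). *)

Set Implicit Arguments.
Unset Strict Implicit.
Unset Printing Implicit Defensive.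

Local Open Scope ring_scope.
Local Open Scope complex_scope.

(** * Functionals bounded by evaluations *)

(** A matrix of maximal rank with rows in E. *)
Lemma spanning_sample (F : fieldType) (m : nat) (E : 'rV[F]_m -> Prop) :
  exists k (B : 'M[F]_(k, m)),
    (forall i, E (row i B)) /\ (forall e, E e -> (e <= B)%MS).
Proof.
pose Q r := `[< exists k (B : 'M[F]_(k, m)),
  (forall i, E (row i B)) /\ \rank B = r >].
have Q0 : exists r, Q r.
  exists 0%N; apply/asboolP; exists 0%N, 0; split; first by case.
  by rewrite mxrank0.
have Qm r : Q r -> (r <= m)%N.
  by move=> /asboolP[k [B [_ <-]]]; exact: rank_leq_col.
case: (ex_maxnP Q0 Qm) => r /asboolP[k [B [EB rB]]] rmax.
exists k, B; split => // e Ee.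
have QeB : Q (\rank (col_mx e B)).
  apply/asboolP; exists (1 + k)%N, (col_mx e B); split=> // i.
  case: (split_ordP i) => i' ->; last by rewrite rowKd.
  by rewrite rowKu row_id.
have := rmax _ QeB; rewrite -rB -addsmxE => le_rank.
have : \rank B == \rank (e + B)%MS by rewrite eqn_leq mxrankS ?addsmxSr.
rewrite (mxrank_leqif_sup (addsmxSr e B)).
exact: submx_trans (addsmxSl e B).
Qed.

(** Finite dimension makes l a combination of finitely many of the rows
    [ev t], and M is the sum of the absolute values of its coefficients. *)
Lemma functional_bounded (R : realFieldType) (T : Type) (A : T -> Prop)
    (m : nat) (ev : T -> 'rV[R]_m) (l : 'rV[R]_m) :
    (forall u : 'cV_m, (forall t, A t -> ev t *m u = 0) -> l *m u = 0) ->
  exists M : R, forall (u : 'cV_m) (N : R),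
    (forall t, A t -> `|(ev t *m u) 0 0| <= N) -> `|(l *m u) 0 0| <= M * N.
Proof.
move=> kerl.
have [k [B [EB spanB]]] :=
  spanning_sample (fun e => exists2 t, A t & e = ev t).
have /submxP[c lE] : (l <= B)%MS.
  (* The columns of [cokermx B] are the vectors that the rows of B kill. *)
  rewrite submxE; apply/eqP/matrixP => i j; rewrite [RHS]mxE.
  have : col j (l *m cokermx B) = 0.
    rewrite colE -mulmxA; apply: kerl => t At.
    have /submxP[d ->] : (ev t <= B)%MS by apply: spanB; exists t.
    by rewrite -mulmxA (mulmxA B) mulmx_coker mul0mx mulmx0.
  by move/matrixP/(_ i 0); rewrite !mxE.
exists (\sum_i `|c 0 i|) => u N evN; rewrite lE -mulmxA mxE mulr_suml.
apply: le_trans (ler_norm_sum _ _ _) _; apply: ler_sum => i _.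
rewrite normrM ler_wpM2l //.
have [t At Bt] := EB i; have := evN t At.
by rewrite -Bt -row_mul mxE.
Qed.

(** * Combinations along a curve of rows satisfying a linear ODE *)

Lemma right_vanishing_derivative (R : realType) (f : R -> R) (t df : R) :
  is_derive t 1 f df -> (forall s, t <= s -> f s = 0) -> df = 0.
Proof.
move=> [dft <-] f0.
have /cvg_dnbhs_at_right lim_right :
    (h^-1 *: (f (h *: 1 + t) - f t) @[h --> 0^'] --> 'D_1 f t)%classic.
  by exact: dft.
apply: (cvg_unique _ lim_right); first exact: norm_hausdorff.
apply: cvg_near_cst; near=> h.
rewrite !f0 ?subrr ?scaler0 // /GRing.scale /= mulr1 lerDr.
near: h; exact: nbhs_right_ge.
Unshelve. all: by end_near.
Qed.

Definition combination (R : realType) (m : nat) (ev : R -> 'rV[R]_m)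
  (u : 'cV[R]_m) (t : R) : R := (ev t *m u) 0 0.

Section linear_ode.
Context (R : realType) (m : nat) (ev : R -> 'rV[R]_m) (D : 'M[R]_m).
Context (ode : forall (u : 'cV[R]_m) (t : R),
  is_derive t 1 (combination ev u) (combination ev (D *m u) t)).

Lemma combination_derive1n j u :
  (combination ev u)^`(j)%classic = combination ev (iter j (mulmx D) u).
Proof.
elim: j => [|j IH]; first by rewrite derive1n0.
rewrite derive1nS IH; apply/funext => t; rewrite derive1E.
by rewrite (@derive_val _ _ _ _ _ _ _ (ode _ t)).
Qed.

Lemma combination_derivable u t : derivable (combination ev u) t 1.
Proof. by have [] := ode u t. Qed.

Lemma mulmx_iter j (e : 'rV[R]_m) (u : 'cV[R]_m) :
  e *m iter j (mulmx D) u = iter j (mulmxr D) e *m u.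
Proof. by elim: j e => //= j IH e; rewrite mulmxA IH -iterSr. Qed.

(** The endpoint 0, where the two-sided derivative also sees t < 0, is the
    delicate one: there the derivative is recovered from the right. *)
Lemma combination_vanishing j u :
  (forall t, 0 <= t -> combination ev u t = 0) ->
  forall t, 0 <= t -> combination ev (iter j (mulmx D) u) t = 0.
Proof.
move=> u0; elim: j => [//|j IH] t t0 /=.
apply: right_vanishing_derivative (ode _ t) _ => s ts.
by apply: IH; exact: le_trans ts.
Qed.

Lemma combination_derivative_bounded j : exists M, forall u N,
  (forall t, 0 <= t -> `|combination ev u t| <= N) ->
  `|(combination ev u)^`(j)%classic 0| <= M * N.
Proof.
have [] := @functional_bounded R R (fun t => 0 <= t) m ev
  (iter j (mulmxr D) (ev 0)).
  move=> u u0; rewrite -mulmx_iter.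
  apply/matrixP => a b; rewrite !ord1 [RHS]mxE.
  by apply: combination_vanishing => // t t0; rewrite /combination u0 // mxE.
by move=> M HM; exists M => u N /HM; rewrite -mulmx_iter combination_derive1n.
Qed.

End linear_ode.

(** * The extremal problem in a translation-invariant class *)

Lemma derive1n_shift (R : realType) (f : R -> R) (h : R) k :
  (fun t => f (t + h))^`(k)%classic = (fun t => f^`(k)%classic (t + h)).
Proof.
elim: k => [//|k IH]; rewrite !derive1nS IH; apply/funext => t.
by rewrite /derive1; under eq_fun do rewrite -addrA.
Qed.

Lemma derive1n_scale (R : realType) (f : R -> R) (a : R) k :
  (forall i t, derivable (f^`(i)%classic) t 1) ->
  (fun t => a * f t)^`(k)%classic = (fun t => a * f^`(k)%classic t).
Proof.
move=> df; elim: k => [//|k IH]; rewrite !derive1nS IH; apply/funext => t.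
rewrite !derive1E; exact: (@deriveZ _ _ _ _ a).
Qed.

Lemma sup_norm_le (R : realType) (g : R -> R) (N : \bar R) :
  (sup_norm g <= N)%E <-> forall t, 0 <= t -> (`|g t|%:E <= N)%E.
Proof.
split=> [gN t t0|gN].
  by apply: le_trans gN; apply: ereal_sup_ubound; exists t.
by apply: ge_ereal_sup => _ [t /= t0 <-]; exact: gN.
Qed.

Section extremal_problem.
Context (R : realType) (P : set (R -> R)) (j : nat).
Context (Pshift : forall p h, P p -> P (fun t => p (t + h))).
Context (Pscale : forall p a, P p -> P (fun t => a * p t)).
Context (Psmooth : forall p k t, P p -> derivable (p^`(k)%classic) t 1).
Context (Pbounded : forall p, P p ->
  exists N, forall t, 0 <= t -> `|p t| <= N).
Context (functional_bound : exists M, forall p N, P p ->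
  (forall t, 0 <= t -> `|p t| <= N) -> `|p^`(j)%classic 0| <= M * N).
Context (functional_nonzero : exists2 p, P p & p^`(j)%classic 0 != 0).

Lemma sup_norm_real p : P p -> exists2 N, 0 <= N & sup_norm p = N%:E.
Proof.
move=> Pp; have [N pN] := Pbounded Pp.
have p0 : (0 <= sup_norm p)%E.
  have /sup_norm_le /(_ 0 (lexx _)) := lexx (sup_norm p).
  by apply: le_trans; rewrite lee_fin.
have : (sup_norm p <= N%:E)%E by apply/sup_norm_le => t t0; rewrite lee_fin pN.
by case: (sup_norm p) p0 => // r r0 _; exists r.
Qed.

(** Translating t to 0 and dividing by the derivative there turns any p with
    p^(j)(t) <> 0 into a competitor of the extremal problem. *)
Lemma normalized_translate p t : P p -> p^`(j)%classic t != 0 ->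
  let q s := (p^`(j)%classic t)^-1 * p (s + t) in
  P q /\ q^`(j)%classic 0 = 1.
Proof.
move=> Pp p0; split; first by apply: Pscale; exact: Pshift.
rewrite derive1n_scale; last by move=> i s; apply: Psmooth; exact: Pshift.
by rewrite derive1n_shift add0r mulVf.
Qed.

Lemma feasible_point : exists2 p, P p & p^`(j)%classic 0 = 1.
Proof.
have [p Pp p1] := functional_nonzero.
have [Pq q1] := normalized_translate Pp p1.
by exists (fun s => (p^`(j)%classic 0)^-1 * p (s + 0)).
Qed.

Lemma objective_value_le p :
  P p -> p^`(j)%classic 0 = 1 -> (objective_value P j <= sup_norm p)%E.
Proof. by move=> Pp p1; apply: ereal_inf_lbound; exists p. Qed.

(** Any bound C on the functional, read on the hyperplane p^(j)(0) = 1, bounds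
    the norm below.  It serves twice: with the constant given by boundedness of
    the functional, for positivity of the objective value, and with any
    admissible Markov-Bernstein constant, for sharpness. *)
Lemma le_objective_value (C : R) :
    (forall p N, P p -> p^`(j)%classic 0 = 1 -> sup_norm p = N%:E ->
      1 <= C * N) ->
  0 < C /\ (C^-1%:E <= objective_value P j)%E.
Proof.
move=> HC; have C_gt0 : 0 < C.
  have [p Pp p1] := feasible_point; have [N N0 pN] := sup_norm_real Pp.
  have CN := HC p N Pp p1 pN; rewrite ltNge; apply/negP => C0.
  by have := le_trans CN (mulr_le0_ge0 C0 N0); rewrite ler10.
split=> //; apply: le_ereal_inf_tmp => _ [p [Pp p1] <-].
have [N _ pN] := sup_norm_real Pp; rewrite pN lee_fin.
by rewrite -[leLHS]mul1r ler_pdivrMr // mulrC; exact: HC pN.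
Qed.

Lemma objective_value_real :
  exists2 mu, 0 < mu & objective_value P j = mu%:E.
Proof.
have [M HM] := functional_bound.
have [p N Pp p1 pN|M_gt0] := @le_objective_value M.
  rewrite -(normr1 R) -p1; apply: HM => // t t0.
  by rewrite -lee_fin -pN; apply/sup_norm_le : t t0.
have [p Pp p1] := feasible_point; have [N _ pN] := sup_norm_real Pp.
have := objective_value_le Pp p1; rewrite pN.
case: (objective_value P j) => // r _; rewrite lee_fin => Mr.
by exists r => //; apply: lt_le_trans Mr; rewrite invr_gt0.
Qed.

Lemma markov_bernstein_constant_objective :
  exists C : R, is_markov_bernstein_constant P j C /\
    C%:E = ((objective_value P j)^-1)%E.
Proof.
have [mu mu_gt0 muE] := objective_value_real.
exists mu^-1; split; last by rewrite muE inver gt_eqF.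
split=> [p Pp|C C_admissible].
  have [N N0 pN] := sup_norm_real Pp.
  apply/sup_norm_le => t t0; rewrite pN -EFinM lee_fin.
  have [->|pt] := eqVneq (p^`(j)%classic t) 0.
    by rewrite normr0 mulr_ge0 // invr_ge0 ltW.
  have [Pq q1] := normalized_translate Pp pt.
  rewrite mulrC ler_pdivlMr // mulrC -ler_pdivlMr ?normr_gt0 //.
  rewrite -lee_fin -muE; apply: le_trans (objective_value_le Pq q1) _.
  apply/sup_norm_le => s s0; rewrite lee_fin normrM normfV mulrC.
  rewrite ler_pM2r ?invr_gt0 ?normr_gt0 //.
  rewrite -lee_fin -pN; apply/sup_norm_le : (s + t) (addr_ge0 s0 t0).
  exact: lexx.
have [p N Pp p1 pN|C_gt0] := @le_objective_value C.
  rewrite -(normr1 R) -p1 -lee_fin EFinM -pN.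
  by have /sup_norm_le/(_ 0 (lexx _)) := C_admissible _ Pp.
rewrite muE lee_fin => le_mu.
by rewrite -[leRHS]invrK lef_pV2 ?posrE ?invr_gt0.
Qed.

End extremal_problem.

(** * Rows of complex numbers *)

Section complex_rows.
Context (R : realType).

Lemma ReM (x y : R[i]) :
  complex.Re (x * y) = complex.Re x * complex.Re y - complex.Im x * complex.Im y.
Proof. by case: x y => [? ?] [? ?]. Qed.

Lemma ImM (x y : R[i]) :
  complex.Im (x * y) = complex.Re x * complex.Im y + complex.Im x * complex.Re y.
Proof. by case: x y => [? ?] [? ?]. Qed.

Context (n : nat).
Implicit Types w : 'I_n -> R[i].

Definition complex_row w : 'rV[R]_(n + n) :=
  row_mx (\row_k complex.Re (w k)) (\row_k complex.Im (w k)).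

(** The real matrix of multiplication by w k in each coordinate k. *)
Definition complex_scaling w : 'M[R]_(n + n) :=
  let a := diag_mx (\row_k complex.Re (w k)) in
  let b := diag_mx (\row_k complex.Im (w k)) in
  block_mx a b (- b) a.

Lemma complex_row_scaling w w' :
  complex_row w *m complex_scaling w' = complex_row (fun k => w k * w' k).
Proof.
rewrite /complex_row mul_row_block mulmxN !mul_mx_diag.
by congr row_mx; apply/rowP => k; rewrite !mxE ?ReM ?ImM.
Qed.

Lemma complex_scalingM w w' :
  complex_scaling w *m complex_scaling w' = complex_scaling (fun k => w k * w' k).
Proof.
rewrite /complex_scaling mulmx_block !(mulNmx, mulmxN) !mulmx_diag.
congr block_mx; apply/matrixP => i k; rewrite !mxE ?ReM ?ImM;
  case: (eqVneq i k) => [->|_] /=; ring.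
Qed.

Lemma complex_scaling1 : complex_scaling (fun=> 1) = 1%:M.
Proof.
rewrite /complex_scaling scalar_mx_block -!diag_const_mx /=.
have -> : \row__ 1 = const_mx 1 :> 'rV[R]_n by apply/rowP => k; rewrite !mxE.
have -> : \row__ 0 = 0 :> 'rV[R]_n by apply/rowP => k; rewrite !mxE.
by rewrite !raddf0 ?oppr0.
Qed.

End complex_rows.

(** * The curve of exponentials *)

Section complex_exponential.
Context (R : realType).

Definition cexp (w : R[i]) (t : R) : R[i] :=
  (expR (complex.Re w * t) * cos (complex.Im w * t))
  +i* (expR (complex.Re w * t) * sin (complex.Im w * t)).

Lemma cexp0 w : cexp w 0 = 1.
Proof. by rewrite /cexp !mulr0 expR0 cos0 sin0 mulr1 mulr0. Qed.

Lemma cexpD w t h : cexp w (t + h) = cexp w t * cexp w h.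
Proof.
rewrite /cexp !mulrDr expRD cosD sinD; simpc.
by congr (_ +i* _); ring.
Qed.

Lemma is_derive_comp_scale (f : R -> R) (a t df : R) :
  is_derive (a * t) 1 f df -> is_derive t 1 (fun s => f (a * s)) (a * df).
Proof.
move=> fdf; have adf : is_derive t 1 ( *%R a) a.
  by rewrite -[X in is_derive _ _ _ X](mulr1 a); exact: (is_deriveZ (f := id) a).
by rewrite mulrC; exact: (is_derive1_comp (f := f) (g := *%R a)).
Qed.

Lemma is_derive_Re_cexp w (t : R) :
  is_derive t 1 (fun s => complex.Re (cexp w s)) (complex.Re (cexp w t * w)).
Proof.
have e := @is_derive_comp_scale expR (complex.Re w) t _ (is_derive_expR _).
have c := @is_derive_comp_scale cos (complex.Im w) t _ (is_derive_cos _).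
apply: is_derive_eq (is_deriveM e c) _.
by rewrite ReM /GRing.scale /=; ring.
Qed.

Lemma is_derive_Im_cexp w (t : R) :
  is_derive t 1 (fun s => complex.Im (cexp w s)) (complex.Im (cexp w t * w)).
Proof.
have e := @is_derive_comp_scale expR (complex.Re w) t _ (is_derive_expR _).
have s := @is_derive_comp_scale sin (complex.Im w) t _ (is_derive_sin _).
apply: is_derive_eq (is_deriveM e s) _.
by rewrite ImM /GRing.scale /=; ring.
Qed.

Lemma cexp_bounded (w : R[i]) (t : R) : complex.Re w <= 0 -> 0 <= t ->
  `|complex.Re (cexp w t)| <= 1 /\ `|complex.Im (cexp w t)| <= 1.
Proof.
move=> w0 t0.
have e1 : `|expR (complex.Re w * t)| <= 1.
  by rewrite ger0_norm ?expR_ge0 // -expR0 ler_expR mulr_le0_ge0.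
by split; rewrite /= normrM mulr_ile1 // ler_norml
  ?cos_geN1 ?cos_le1 ?sin_geN1 ?sin_le1.
Qed.

End complex_exponential.

Section exponential_curve.
Context (R : realType) (n : nat) (z : 'I_n -> R[i]).
Implicit Types u : 'cV[R]_(n + n).

Definition exp_row (t : R) : 'rV[R]_(n + n) := complex_row (fun k => cexp (z k) t).

Lemma exp_combinationE u : combination exp_row u = (fun t =>
  \sum_k (usubmx u k 0 * complex.Re (cexp (z k) t)
        + dsubmx u k 0 * complex.Im (cexp (z k) t))).
Proof.
apply/funext => t; rewrite /combination -[u in LHS]vsubmxK mul_row_col.
rewrite !mxE -big_split /=.
by apply: eq_bigr => k _; rewrite !mxE /=; ring.
Qed.

Lemma quasipolynomialE : quasipolynomial z = range (combination exp_row).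
Proof.
apply/seteqP; split=> [p [c [d ->]]|p [u _ <-]] /=.
  exists (col_mx (\col_k c k) (\col_k d k)) => //.
  rewrite exp_combinationE; apply/funext => t; apply: eq_bigr => k _.
  by rewrite col_mxKu col_mxKd !mxE.
rewrite exp_combinationE.
by exists (fun k => usubmx u k 0), (fun k => dsubmx u k 0).
Qed.

Lemma exp_row_scaling t w :
  exp_row t *m complex_scaling w = complex_row (fun k => cexp (z k) t * w k).
Proof. exact: complex_row_scaling. Qed.

Lemma is_derive_exp_combination u (t : R) :
  is_derive t 1 (combination exp_row u)
    (combination exp_row (complex_scaling z *m u) t).
Proof.
rewrite {2}/combination mulmxA exp_row_scaling exp_combinationE.
have -> : (fun t => \sum_k (usubmx u k 0 * complex.Re (cexp (z k) t)
                          + dsubmx u k 0 * complex.Im (cexp (z k) t))) =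
    \sum_(k < n) (usubmx u k 0 *: (fun t => complex.Re (cexp (z k) t))
                + dsubmx u k 0 *: (fun t => complex.Im (cexp (z k) t))).
  by apply/funext => s; rewrite fct_sumE.
apply: is_derive_eq (is_derive_sum (fun k => is_deriveD
  (is_deriveZ (usubmx u k 0) (is_derive_Re_cexp (z k) t))
  (is_deriveZ (dsubmx u k 0) (is_derive_Im_cexp (z k) t)))) _.
rewrite -[u in RHS]vsubmxK mul_row_col !mxE -big_split /=.
by apply: eq_bigr => k _; rewrite !mxE /GRing.scale /=; ring.
Qed.

Lemma exp_combination_shift u (h : R) :
  (fun t => combination exp_row u (t + h)) =
  combination exp_row (complex_scaling (fun k => cexp (z k) h) *m u).
Proof.
apply/funext => t; rewrite /combination mulmxA exp_row_scaling /exp_row.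
congr ((complex_row _ *m u) 0 0); apply/funext => k; exact: cexpD.
Qed.

Lemma exp_combination_bounded u : (forall k, complex.Re (z k) <= 0) ->
  exists N, forall t, 0 <= t -> `|combination exp_row u t| <= N.
Proof.
move=> z0; exists (\sum_k (`|usubmx u k 0| + `|dsubmx u k 0|)) => t t0.
rewrite exp_combinationE; apply: le_trans (ler_norm_sum _ _ _) _.
apply: ler_sum => k _; have [re im] := cexp_bounded (z0 k) t0.
apply: le_trans (ler_normD _ _) _.
by apply: lerD; rewrite [leLHS]normrM ler_piMr.
Qed.

(** Scaling by 1/z inverts differentiation, so some element of the class has
    j-th derivative Re e^(z_0 t), which is 1 at t = 0. *)
Lemma exp_derivative_nonzero j : (0 < n)%N -> (forall k, z k != 0) ->
  exists u, (combination exp_row u)^`(j)%classic 0 != 0.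
Proof.
move=> n0 z0; pose k0 := Ordinal n0.
pose D := complex_scaling z; pose D' := complex_scaling (fun k => (z k)^-1).
have DD' : D *m D' = 1%:M.
  rewrite complex_scalingM -complex_scaling1; congr complex_scaling.
  by apply/funext => k; rewrite mulfV.
have DKj (u : 'cV_(n + n)) : iter j (mulmx D) (iter j (mulmx D') u) = u.
  elim: j => // i IH; rewrite [iter i.+1 _ (iter _ _ _)]iterSr [X in mulmx D X]iterS.
  by rewrite mulmxA DD' mul1mx.
exists (iter j (mulmx D') (delta_mx (lshift n k0) 0)).
rewrite (combination_derive1n is_derive_exp_combination) DKj.
rewrite /combination -colE mxE row_mxEl mxE cexp0 /=.
exact: oner_neq0.
Qed.

End exponential_curve.

Theorem proposition3 (R : realType) (n : nat) (n_gt0 : (0 < n)%N)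
    (z : 'I_n -> R[i]) (z_inj : injective z)
    (z_lt0 : forall k, complex.Re (z k) < 0)
    (j : nat) (j_ge1 : (1 <= j)%N) :
  exists C : R,
    is_markov_bernstein_constant (quasipolynomial z) j C /\
    C%:E = ((objective_value (quasipolynomial z) j)^-1)%E.
Proof.
have ode := @is_derive_exp_combination R n z.
rewrite quasipolynomialE; apply: markov_bernstein_constant_objective.
- by move=> _ h [u _ <-]; rewrite exp_combination_shift; exact: imageT.
- move=> _ a [u _ <-]; exists (a *: u) => //.
  by apply/funext => t; rewrite /combination -scalemxAr mxE.
- move=> _ k t [u _ <-]; rewrite (combination_derive1n ode).
  exact: combination_derivable ode _ _.
- by move=> _ [u _ <-]; apply: exp_combination_bounded => k; exact: ltW.
- have [M HM] := combination_derivative_bounded ode j.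
  by exists M => _ N [u _ <-]; exact: HM.
- have [k|u u0] := @exp_derivative_nonzero R n z j n_gt0.
    by apply: contraTneq (z_lt0 k) => ->; rewrite ltxx.
  by exists (combination (exp_row z) u) => //; exact: imageT.
Qed.
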